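(* Let $Y=[0,1]^d$, let $|\cdot|=|\cdot|_\infty$ be the max vector norm, and let $Z\subset\mathbb{R}$, $X\subset\mathbb{R}$. Let $\mathcal{L}:Y\to Z$ and $G:Z\to X$, and set $\mathcal{G}(y)=G(\mathcal{L}(y))$ for $y\in Y$. Assume: (H1) $\mathcal{L}\in W^{2,\infty}(Y)$ with $C_{\mathcal{L}}:=\|\mathcal{L}\|_{W^{2,\infty}(Y)}\le\frac13$. (H2) $G\in W^{2,\infty}(Z)$ with $C_G:=\|G\|_{W^{2,\infty}(Z)}\le\frac13$. (H3) $\mathcal{G}$ has exactly one global minimum, at $\bar y$, and no other local minima. (H4) $\nabla\mathcal{G}:Y\to\mathcal{Y}\subset\mathbb{R}^d$ is invertible with inverse $\nabla\mathcal{G}^{-1}:\mathcal{Y}\to Y$, and $\nabla\mathcal{G}^{-1}\in W^{1,\infty}(\mathcal{Y})$, with $C_{-1}:=\|\nabla\mathcal{G}^{-1}\|_{W^{1,\infty}(\mathcal{Y})}$. Run the ISMO algorithm described in the context, with initial training set $\mathcal{S}_0=\{y_i^0\}_{1\le i\le N_0}\subset Y$ and batch size $\Delta N\le N_0$. It produces training sets $\mathcal{S}_k$, neural networks $\mathcal{L}_k^*$, surrogate costs $\mathcal{G}_k^*=G(\mathcal{L}_k^* )$ and points $\bar y_j^k$ ($1\le j\le\Delta N$), $k=0,1,2,\dots$. Let the neural networks at every step $k$ be trained with the Lipschitz loss function $$\mathcal{E}_T^{Lip,k}(\theta)=\max_{y_i\in\mathcal{S}_k}\Big(|\mathcal{L}(y_i)-\mathcal{L}_\theta(y_i)|+|\nabla\mathcal{L}(y_i)-\nabla\mathcal{L}_\theta(y_i)|\Big),$$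 that is, $\theta_k^*=\operatorname{argmin}_{\theta\in\Theta}\mathcal{E}_T^{Lip,k}(\theta)$, $\mathcal{L}_k^*=\mathcal{L}_{\theta_k^*}$, $\mathcal{E}_T^{Lip,k,*}=\mathcal{E}_T^{Lip,k}(\theta_k^* )$, and write $C_{\mathcal{L}_k^*}=\|\mathcal{L}_k^*\|_{W^{2,\infty}(Y)}$. Assume further: (H5) $Y\subset\bigcup_{i=1}^{N_0}B(y_i^0,N_0^{-1/d})$, where $B(y,r)$ denotes the $|\cdot|_\infty$-ball centered at $y$ with diameter $r$. (H6) At every step $k\ge0$ the standard optimization algorithm converges (with a finite number of iterations) from each of its starting values to a local minimum $\bar y_j^k\in Y$ of $\mathcal{G}_k^*$ such that $\nabla\mathcal{G}_k^*(\bar y_j^k)=0$, $1\le j\le\Delta N$. Let the trained network $\mathcal{L}_0^*$ be well-trained, i.e. $\|\mathcal{L}_0^*\|_{W^{2,\infty}(Y)}\le\frac13$ and $\mathcal{E}_T^{Lip,0,*}\le\frac13N_0^{-1/d}$, and let the number of initial training points $N_0=\#(\mathcal{S}_0)$ be chosen such that $$N_0\ge\left(\frac{C}{\sigma_0}\right)^d\quad\text{for some }\sigma_0<1,\qquad C=\frac{4C_{-1}}{9}.$$ Given this $\sigma_0$, define for $k\ge1$ $$\sigma_k=\mathcal{E}_T^{Lip,k,*}+\Big(\frac13+C_{\mathcal{L}_k^*}\Big)\frac{\sigma_{k-1}}{(\Delta N)^{1/d}}.$$ Under the assumption that the local minimizers also satisfy (H7) $\displaystyle \bar y_j^k\in\bigcup_{i=1}^{\Delta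 N}B\Big(\bar y_i^{k-1},\frac{\sigma_{k-1}}{(\Delta N)^{1/d}}\Big)$ for all $k\ge1$ and $1\le j\le\Delta N$, the approximate minimizers satisfy, for all $k\ge1$ and $1\le j\le\Delta N$, $$|\bar y-\bar y_j^k|\le C\sigma_k.$$ In particular, if at every step $k\ge1$ the trained neural network $\mathcal{L}_k^*$ is well-trained, i.e. it satisfies $$\|\mathcal{L}_k^*\|_{W^{2,\infty}(Y)}\le\frac13,\qquad \mathcal{E}_T^{Lip,k,*}\le\frac13\,\frac{\sigma_{k-1}}{(\Delta N)^{1/d}},$$ then the minimizers generated by the ISMO algorithm satisfy, for all $1\le j\le\Delta N$, $$|\bar y-\bar y_j^k|\le\frac{C^k\sigma_0}{(\Delta N)^{k/d}}\qquad\forall k\ge1.$$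
   Context: Neural networks: for some $K>1$, widths $d_1=d,d_2,\dots,d_K,d_{K+1}=1$ and a scalar activation function $\sigma\in W^{2,\infty}(\mathbb{R})$ applied componentwise (unrelated to the numbers $\sigma_k$), and for $\theta=\{W_k,b_k\}_{1\le k\le K}$ with $W_k\in\mathbb{R}^{d_{k+1}\times d_k}$, $b_k\in\mathbb{R}^{d_{k+1}}$, set $A_k(z)=W_kz+b_k$ and $\mathcal{L}_\theta=A_K\circ\sigma\circ A_{K-1}\circ\cdots\circ\sigma\circ A_1$. The parameter set is $\Theta\subset\mathbb{R}^M$ with $M=\sum_{k=1}^K(d_k+1)d_{k+1}$, and $\mathcal{L}_\theta\in W^{2,\infty}(Y)$ for every $\theta\in\Theta$. Standard (quasi-Newton) optimization algorithm for a cost function $g$ on $Y$: given a starting value $x_0\in Y$ and a starting Hessian $B_0\in\mathbb{R}^{d\times d}$, at step $m$ solve $B_mp_m=-\nabla g(x_m)$, set $\beta_m=\operatorname{argmin}_{\beta\in[0,1]}g(x_m+\beta p_m)$ and $x_{m+1}=x_m+\beta_mp_m$, and update $B_{m+1}=\mathcal{F}(B_m,x_m,x_{m+1},\nabla g(x_m),\nabla g(x_{m+1}))$ by some update formula $\mathcal{F}$; terminate when $|x_{m+1}-x_m|$ is smaller than a tolerance. ISMO algorithm (iterative surrogate model optimization): inputs are $\mathcal{L}$, $G$, an initial training set $\mathcal{S}_0=\{y_i^0\}_{1\le i\le N_0}\subset Y$ and a batch size $\Delta N\le N_0$. At each step $k=0,1,2,\dots$: (i) train a neural network $\mathcal{L}_k^*$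 on the training set $\mathcal{S}_k$ by running a (stochastic) gradient descent algorithm to minimize the loss function over $\theta\in\Theta$, and set $\mathcal{G}_k^*=G(\mathcal{L}_k^* )$; (ii) draw $\Delta N$ random starting values $\tilde y_1^k,\dots,\tilde y_{\Delta N}^k$ in $Y$ and run the standard optimization algorithm with cost function $\mathcal{G}_k^*$ from each $\tilde y_j^k$, obtaining the approximate minimizers $\bar y_j^k$, $1\le j\le\Delta N$; (iii) set $\bar{\mathcal{S}}_k=\{\bar y_j^k\}_{1\le j\le\Delta N}$ and $\mathcal{S}_{k+1}=\mathcal{S}_k\cup\bar{\mathcal{S}}_k$. For $k\ge1$ the iteration is terminated if $\big|\frac1{\Delta N}\sum_{j=1}^{\Delta N}\mathcal{G}(\bar y_j^k)-\frac1{\Delta N}\sum_{j=1}^{\Delta N}\mathcal{G}(\bar y_j^{k-1})\big|\le\epsilon$ for some tolerance $\epsilon\ll1$; otherwise it continues to step $k+1$.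
   Formalization: (H3) is supplemented by the condition that the gradient of the cost vanishes at its minimum (the claim fails for minima on the boundary with nonzero gradient), and W^{1,∞}, W^{2,∞} norms are read via sup norms and max-norm Lipschitz constants, also on the set 𝒴. *)

(* Defs.v *)
From HB Require Import structures.
From mathcomp Require Import all_boot all_order all_algebra finmap.
From mathcomp Require Import all_classical all_reals all_analysis.

Set Implicit Arguments.
Unset Strict Implicit.
Unset Printing Implicit Defensive.

Import Order.TTheory GRing.Theory Num.Theory.
Import numFieldNormedType.Exports.

Local Open Scope classical_set_scope.
Local Open Scope ring_scope.

(* The norm `|v| of mathcomp-analysis on 'cV[R]_d is the max norm. *)

Definition unit_cube (R : realType) (d : nat) : set 'cV[R]_d :=
  [set y | forall i, 0 <= y i 0 <= 1].
Arguments unit_cube : clear implicits.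

(* The ball of DIAMETER r.  It is closed: N open max-norm balls of diameter
   N^(-1/d) have total volume 1 and so can never cover [0,1]^d. *)
Definition ball_diam (R : realType) (d : nat) (x : 'cV[R]_d) (r : R) :
    set 'cV[R]_d :=
  [set z | `|z - x| <= r / 2].

Definition is_argmin (R : realType) (T : Type) (A : set T) (f : T -> R)
    (x : T) : Prop :=
  A x /\ forall z, A z -> f x <= f z.

Definition local_min (R : realType) (V : normedModType R) (A : set V)
    (f : V -> R) (x : V) : Prop :=
  A x /\ \forall z \near within A (nbhs x), f x <= f z.

Definition dotc (R : realType) (d : nat) (u v : 'cV[R]_d) : R :=
  \sum_i u i 0 * v i 0.

Definition dotr (R : realType) (u v : R) : R := u * v.

(* Gradient of f at x relative to A, so that it also makes sense on the
   boundary of A.  The pairing dot is dotc on 'cV[R]_d, and dotr on R, where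
   the gradient is the derivative. *)
Definition is_grad (R : realType) (V : normedModType R) (dot : V -> V -> R)
    (A : set V) (f : V -> R) (x g : V) : Prop :=
  forall e : R, 0 < e -> \forall z \near within A (nbhs x),
    `|f z - f x - dot g (z - x)| <= e * `|z - x|.

Definition grad (R : realType) (V : normedModType R) (dot : V -> V -> R)
    (A : set V) (f : V -> R) (x : V) : V :=
  xget 0 [set g | is_grad dot A f x g].

(* W^{1,oo}(A) is read as the space of bounded Lipschitz functions on A, and
   W^{2,oo}(A) as the space of functions f such that f and its gradient are in
   W^{1,oo}(A).  On a convex set with nonempty interior the best Lipschitz
   constant is the essential supremum of the (dual, resp. operator) norm of the
   weak derivative, so that the norms below are
   max(|f|_oo, |Df|_oo, ..., |D^k f|_oo). *)
Definition W1inf (R : realType) (V W : normedModType R) (A : set V)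
    (f : V -> W) : Prop :=
  [bounded f x | x in A] /\ [lipschitz f x | x in A].

Definition sup_norm (R : realType) (V W : normedModType R) (A : set V)
    (f : V -> W) : R :=
  sup [set `|f x| | x in A].

Definition lip_const (R : realType) (V W : normedModType R) (A : set V)
    (f : V -> W) : R :=
  inf [set k : R | 0 <= k /\ k.-lipschitz_A f].

Definition W1inf_norm (R : realType) (V W : normedModType R) (A : set V)
    (f : V -> W) : R :=
  Num.max (sup_norm A f) (lip_const A f).

(* Uniqueness of the gradient rules out sets A (e.g. with isolated points) on
   which f does not determine it. *)
Definition W2inf (R : realType) (V : normedModType R) (dot : V -> V -> R)
    (A : set V) (f : V -> R) : Prop :=
  [/\ forall x, A x -> exists! g, is_grad dot A f x g,
      W1inf A f & W1inf A (grad dot A f)].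

Definition W2inf_norm (R : realType) (V : normedModType R) (dot : V -> V -> R)
    (A : set V) (f : V -> R) : R :=
  Num.max (W1inf_norm A f) (W1inf_norm A (grad dot A f)).

(* Weights and biases of a network with input dimension n, hidden widths ws
   and output dimension 1; there are K = size ws + 1 affine layers. *)
Fixpoint net_params (R : realType) (n : nat) (ws : seq nat) : Type :=
  if ws is m :: ws' then
    (('M[R]_(m, n) * 'cV[R]_m) * net_params R m ws')%type
  else ('M[R]_(1, n) * 'cV[R]_1)%type.

Fixpoint network (R : realType) (act : R -> R) (n : nat) (ws : seq nat) :
    net_params R n ws -> 'cV[R]_n -> R :=
  match ws return net_params R n ws -> 'cV[R]_n -> R with
  | [::] => fun theta z => (theta.1 *m z + theta.2) 0 0
  | m :: ws' => fun theta z =>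
      network act theta.2 (map_mx act (theta.1.1 *m z + theta.1.2))
  end.

(* The quasi-Newton algorithm for the cost g on Y, with starting value x0 and
   starting Hessian B0, stops after finitely many steps and returns xout.  The
   line search only ranges over points of Y, where g is defined. *)
Definition quasi_newton (R : realType) (d : nat)
    (update : 'M[R]_d -> 'cV[R]_d -> 'cV[R]_d -> 'cV[R]_d -> 'cV[R]_d ->
              'M[R]_d)
    (tol : R) (Y : set 'cV[R]_d) (g : 'cV[R]_d -> R)
    (B0 : 'M[R]_d) (x0 xout : 'cV[R]_d) : Prop :=
  let Dg := grad (@dotc R d) Y g in
  exists (n : nat) (x p : nat -> 'cV[R]_d) (B : nat -> 'M[R]_d)
         (beta : nat -> R),
  [/\ x 0%N = x0 /\ B 0%N = B0,
      forall m, (m <= n)%N ->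
        [/\ B m *m p m = - Dg (x m),
            is_argmin [set b | 0 <= b <= 1 /\ Y (x m + b *: p m)]
                      (fun b => g (x m + b *: p m)) (beta m),
            x m.+1 = x m + beta m *: p m
          & B m.+1 = update (B m) (x m) (x m.+1) (Dg (x m)) (Dg (x m.+1))],
      forall m, (m < n)%N -> tol <= `|x m.+1 - x m|,
      `|x n.+1 - x n| < tol
    & xout = x n.+1].

Fixpoint train_set (R : realType) (d N0 dN : nat) (y0 : 'I_N0 -> 'cV[R]_d)
    (ybar : nat -> 'I_dN -> 'cV[R]_d) (k : nat) : {fset 'cV[R]_d} :=
  if k is k'.+1 then
    (train_set y0 ybar k' `|` [fset ybar k' j | j : 'I_dN])%fset
  else [fset y0 i | i : 'I_N0]%fset.

Definition lip_loss (R : realType) (d : nat) (Y : set 'cV[R]_d)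
    (L : 'cV[R]_d -> R) (S : {fset 'cV[R]_d}) (f : 'cV[R]_d -> R) : R :=
  \big[Num.max/0]_(y <- S)
    (`|L y - f y| + `|grad (@dotc R d) Y L y - grad (@dotc R d) Y f y|).

(* Step k of ISMO is executed iff the stopping test has failed at all steps
   1, ..., k-1.  With eps < 0 every step is executed. *)
Definition executed (R : realType) (d dN : nat) (cost : 'cV[R]_d -> R)
    (eps : R) (ybar : nat -> 'I_dN -> 'cV[R]_d) (k : nat) : Prop :=
  let avg i := dN%:R^-1 * \sum_j cost (ybar i j) in
  forall i, (0 < i < k)%N -> eps < `|avg i - avg i.-1|.

Fixpoint ismo_sigma (R : realType) (d dN : nat) (E CL : nat -> R) (sigma0 : R)
    (k : nat) : R :=
  if k is k'.+1 then
    E k + (3^-1 + CL k) *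
          (ismo_sigma d dN E CL sigma0 k' / dN%:R `^ d%:R^-1)
  else sigma0.

(* Main.v *)
Require Import Defs.
From HB Require Import structures.
From mathcomp Require Import all_boot all_order all_algebra finmap.
From mathcomp Require Import all_classical all_reals all_analysis.
From mathcomp Require Import lra ring.

Set Implicit Arguments.
Unset Strict Implicit.
Unset Printing Implicit Defensive.

Import Order.TTheory GRing.Theory Num.Theory.
Import numFieldNormedType.Exports.

Local Open Scope classical_set_scope.
Local Open Scope ring_scope.

(** Let [z] be a minimizer produced at step [k >= 1]. Since the gradient of
    [G \o Lnet k] vanishes at [z] and that of the cost [G \o L] vanishes at
    [ymin], the Lipschitz inverse of the latter gradient gives
      [|ymin - z| <= Cinv * |grad (G \o L) z - grad (G \o Lnet k) z|].
    By the chain rule the right-hand side is at most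
      [Cinv * (|L z - Lnet k z| / 9 + |grad L z - grad (Lnet k) z| / 3)]
    ([grad_surrogate_dist]). The point [z] lies at distance at most
    [r / 2], with [r = sigma_(k-1) / dN ^ (1 / d)], from a minimizer of step
    [k - 1], which is a training point of step [k]. As [L], [Lnet k] and their
    gradients are Lipschitz, the sum of the two errors at [z] is at most
    [E k + (1 / 3 + CL k) * r = sigma k] ([lip_loss_transport]), where [CL k] is
    the [W^{2,oo}] norm of [Lnet k]. Hence
    [|ymin - z| <= Cinv / 3 * sigma k <= C * sigma k].

    When the networks are well-trained, the recursion defining [sigma] yields
    [sigma k <= sigma0 / dN ^ (k / d)] ([ismo_sigma_le]). The power [C ^ k],
    in place of [C], is harmless because [C >= 1]: the gradient of the cost is
    [4 / 27]-Lipschitz, so that its inverse has [Cinv >= 27 / 4]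
    ([lipschitz_inverse_ge1]).

    The Lipschitz constants in the norms are infima, which are meaningful only
    for functions that are Lipschitz at all. So it has to be checked that
    networks belong to [W^{2,oo}] of the cube ([network_W2inf]). Gradients
    relative to the cube are unique because they are so for [L]
    ([is_grad_unique]). *)

(** * Bounded and Lipschitz functions *)

Section BoundedLipschitz.
Variable R : realType.
Implicit Types V W U : normedModType R.

Lemma bounded_onP V W (A : set V) (f : V -> W) :
  [bounded f x | x in A] <->
  exists2 M : R, 0 <= M & forall x, A x -> `|f x| <= M.
Proof.
split=> [[M [_ HM]]|[M M0 HM]].
  exists (Num.max 0 M + 1) => [|x Ax]; first by rewrite addr_ge0 ?le_max ?lexx.
  by apply: HM => //; rewrite ltr_pwDr ?le_max ?lexx ?orbT.
exists M; split=> [|N MN x Ax]; first exact: num_real.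
exact: le_trans (HM x Ax) (ltW MN).
Qed.

Lemma lipschitz_onP V W (A : set V) (f : V -> W) :
  [lipschitz f x | x in A] <->
  exists2 M : R, 0 <= M &
    forall x y, A x -> A y -> `|f x - f y| <= M * `|x - y|.
Proof.
split=> [[M [_ HM]]|[M M0 HM]].
  exists (Num.max 0 M + 1) => [|x y Ax Ay].
    by rewrite addr_ge0 ?le_max ?lexx.
  have MN : M < Num.max 0 M + 1 by rewrite ltr_pwDr ?le_max ?lexx ?orbT.
  exact: (HM _ MN (x, y)).
exists M; split=> [|N MN [x y] /= [Ax Ay]]; first exact: num_real.
apply: le_trans (HM x y Ax Ay) _.
by rewrite ler_wpM2r ?normr_ge0// ltW.
Qed.

Lemma lip_const_ge0 V W (A : set V) (f : V -> W) : 0 <= lip_const A f.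
Proof.
rewrite /lip_const; set K := [set k | _].
have [K0|/set0P[k Kk]] := eqVneq K set0; first by rewrite K0 inf0.
by apply: lb_le_inf; [exists k | move=> l []].
Qed.

(** The infimum of the Lipschitz constants is itself a Lipschitz constant,
    provided that there is one. *)
Lemma lip_constP V W (A : set V) (f : V -> W) :
  [lipschitz f x | x in A] ->
  forall x y, A x -> A y -> `|f x - f y| <= lip_const A f * `|x - y|.
Proof.
move=> /lipschitz_onP[M M0 HM] x y Ax Ay.
have [->|xy] := eqVneq x y; first by rewrite !subrr !normr0 mulr0.
have xy0 : 0 < `|x - y| by rewrite normr_gt0 subr_eq0.
rewrite -ler_pdivrMr//; apply: lb_le_inf.
  by exists M; split=> // -[u v] /= [Au Av]; exact: HM.
move=> k [_ Hk]; rewrite ler_pdivrMr//.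
exact: (Hk (x, y)).
Qed.

Lemma sup_normP V W (A : set V) (f : V -> W) :
  [bounded f x | x in A] -> forall x, A x -> `|f x| <= sup_norm A f.
Proof.
move=> /bounded_onP[M M0 HM] x Ax; apply: ub_le_sup; last by exists x.
by exists M => _ [z Az <-]; exact: HM.
Qed.

Lemma lipschitz_onS V W (A B : set V) (f : V -> W) :
  A `<=` B -> [lipschitz f x | x in B] -> [lipschitz f x | x in A].
Proof.
move=> AB /lipschitz_onP[M M0 HM]; apply/lipschitz_onP.
by exists M => // x y /AB Bx /AB By; exact: HM.
Qed.

Lemma lipschitz_bounded V W (A : set V) (f : V -> W) :
  [bounded x | x in A] -> [lipschitz f x | x in A] -> W1inf A f.
Proof.
move=> /bounded_onP[N N0 HN] f_lip; split=> //.
have /lipschitz_onP[M M0 HM] := f_lip.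
have [->|/set0P[a Aa]] := eqVneq A set0; first by apply/bounded_onP; exists 0.
apply/bounded_onP; exists (`|f a| + M * (N + N)) => [|x Ax].
  by rewrite addr_ge0 ?mulr_ge0 ?addr_ge0.
rewrite -[f x](subrK (f a)) addrC (le_trans (ler_normD _ _))// lerD2l.
rewrite (le_trans (HM _ _ Ax Aa))// ler_wpM2l//.
by rewrite (le_trans (ler_normB _ _))// lerD ?HN.
Qed.

Lemma lipschitz_cst V W (A : set V) (c : W) : [lipschitz c | _ in A].
Proof.
by apply/lipschitz_onP; exists 0 => // x y _ _; rewrite subrr normr0 mul0r.
Qed.

Lemma lipschitzD V W (A : set V) (f g : V -> W) :
  [lipschitz f x | x in A] -> [lipschitz g x | x in A] ->
  [lipschitz f x + g x | x in A].
Proof.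
move=> /lipschitz_onP[M M0 HM] /lipschitz_onP[N N0 HN].
apply/lipschitz_onP; exists (M + N) => [|x y Ax Ay]; first exact: addr_ge0.
rewrite opprD addrACA mulrDl.
exact: le_trans (ler_normD _ _) (lerD (HM _ _ Ax Ay) (HN _ _ Ax Ay)).
Qed.

Lemma lipschitz_comp V W U (A : set V) (B : set W) (f : V -> W) (g : W -> U) :
  set_fun A B f -> [lipschitz f x | x in A] -> [lipschitz g x | x in B] ->
  [lipschitz g (f x) | x in A].
Proof.
move=> AB /lipschitz_onP[M M0 HM] /lipschitz_onP[N N0 HN].
apply/lipschitz_onP; exists (N * M) => [|x y Ax Ay]; first exact: mulr_ge0.
apply: le_trans (HN _ _ (AB _ Ax) (AB _ Ay)) _.
by rewrite -mulrA ler_wpM2l// HM.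
Qed.

Lemma W1inf_cst V W (A : set V) (c : W) : W1inf A (fun=> c).
Proof.
split; last exact: lipschitz_cst.
by apply/bounded_onP; exists `|c|.
Qed.

Lemma W1infD V W (A : set V) (f g : V -> W) :
  W1inf A f -> W1inf A g -> W1inf A (fun x => f x + g x).
Proof.
move=> [/bounded_onP[M M0 HM] lf] [/bounded_onP[N N0 HN] lg].
split; last exact: lipschitzD.
apply/bounded_onP; exists (M + N) => [|x Ax]; first exact: addr_ge0.
exact: le_trans (ler_normD _ _) (lerD (HM _ Ax) (HN _ Ax)).
Qed.

Lemma W1inf_sum V W (A : set V) n (f : 'I_n -> V -> W) :
  (forall i, W1inf A (f i)) -> W1inf A (fun x => \sum_i f i x).
Proof.
elim: n f => [|n IHn] f Hf.
  have -> : (fun x => \sum_(i < 0) f i x) = fun=> 0.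
    by apply: funext => x; rewrite big_ord0.
  exact: W1inf_cst.
have -> : (fun x => \sum_i f i x) =
    fun x => f ord0 x + \sum_i f (lift ord0 i) x.
  by apply: funext => x; rewrite big_ord_recl.
by apply: W1infD => //; exact: IHn.
Qed.

Lemma W1infM V (A : set V) (f g : V -> R) :
  W1inf A f -> W1inf A g -> W1inf A (fun x => f x * g x).
Proof.
move=> [/bounded_onP[M M0 HM] /lipschitz_onP[M' M'0 HM']].
move=> [/bounded_onP[N N0 HN] /lipschitz_onP[N' N'0 HN']].
split.
  apply/bounded_onP; exists (M * N) => [|x Ax]; first exact: mulr_ge0.
  by rewrite normrM ler_pM// ?HM ?HN.
apply/lipschitz_onP; exists (M * N' + M' * N) => [|x y Ax Ay].
  by rewrite addr_ge0// mulr_ge0.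
have -> : f x * g x - f y * g y = f x * (g x - g y) + (f x - f y) * g y.
  by ring.
rewrite (le_trans (ler_normD _ _))// !normrM mulrDl lerD//.
  by rewrite -mulrA ler_pM ?HM ?HN'.
by rewrite mulrAC ler_pM ?HM' ?HN.
Qed.

Lemma W1inf_comp V W U (A : set V) (B : set W) (f : V -> W) (g : W -> U) :
  set_fun A B f -> [lipschitz f x | x in A] -> W1inf B g ->
  W1inf A (fun x => g (f x)).
Proof.
move=> AB lf [/bounded_onP[M M0 HM] lg]; split; last exact: lipschitz_comp lg.
by apply/bounded_onP; exists M => // x /AB; exact: HM.
Qed.

Lemma ler_norm_coord n (v : 'cV[R]_n) i : `|v i 0| <= `|v|.
Proof.
rewrite [leRHS]/Num.Def.normr /= mx_normrE.
by apply/bigmax_geP; right => /=; exists (i, 0).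
Qed.

Lemma norm_col_le n (v : 'cV[R]_n) (M : R) :
  0 <= M -> (forall i, `|v i 0| <= M) -> `|v| <= M.
Proof.
move=> M0 HM; rewrite [leLHS]/Num.Def.normr /= mx_normrE.
by apply/bigmax_leP; split=> // -[i j] _ /=; rewrite ord1.
Qed.

Lemma lipschitz_col V (A : set V) n (f : V -> 'cV[R]_n) :
  (forall i, [lipschitz f x i 0 | x in A]) -> [lipschitz f x | x in A].
Proof.
move=> lf.
have /choice[M HM] : forall i, exists M : R, 0 <= M /\
    forall x y, A x -> A y -> `|f x i 0 - f y i 0| <= M * `|x - y|.
  by move=> i; have /lipschitz_onP[M M0 HM] := lf i; exists M.
have S0 : 0 <= \sum_i M i by rewrite sumr_ge0// => i _; case: (HM i).
apply/lipschitz_onP; exists (\sum_i M i) => // x y Ax Ay.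
apply: norm_col_le => [|i]; first by rewrite mulr_ge0.
rewrite !mxE; have [Mi0 HMi] := HM i; apply: le_trans (HMi x y Ax Ay) _.
rewrite ler_wpM2r// (bigD1 i)//= lerDl sumr_ge0// => j _.
by case: (HM j).
Qed.

Lemma lipschitz_affine n m (W : 'M[R]_(m, n)) (b : 'cV[R]_m)
    (A : set 'cV[R]_n) i :
  [lipschitz (W *m z + b) i 0 | z in A].
Proof.
apply/lipschitz_onP; exists (\sum_j `|W i j|) => [|x y _ _].
  by rewrite sumr_ge0.
rewrite !mxE opprD addrACA subrr addr0 -sumrB mulr_suml.
rewrite (le_trans (ler_norm_sum _ _ _))//.
apply: ler_sum => j _; rewrite -mulrBr normrM ler_wpM2l//.
by have := ler_norm_coord (x - y) j; rewrite !mxE.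
Qed.

End BoundedLipschitz.

(** * Relative gradients *)

Section Gradients.
Variable R : realType.
Implicit Types V W : normedModType R.

(** [r z] is negligible with respect to [z - x] as [z] tends to [x] in [A]. *)
Definition smallo V (A : set V) (x : V) (r : V -> R) : Prop :=
  forall e : R, 0 < e -> \forall z \near within A (nbhs x),
    `|r z| <= e * `|z - x|.

Lemma smalloP V (A : set V) (x : V) (r : V -> R) :
  smallo A x r <-> forall e : R, 0 < e -> exists2 dl : R, 0 < dl &
    forall z, A z -> `|z - x| < dl -> `|r z| <= e * `|z - x|.
Proof.
split=> H e e0.
  have /nbhs_normP[dl dl0 Hdl] := H e e0.
  exists dl => // z Az zx; apply: Hdl => //.
  by rewrite /= distrC.
have [dl dl0 Hdl] := H e e0.
apply/nbhs_normP; exists dl => // z /= zx Az.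
by apply: Hdl => //; rewrite distrC.
Qed.

Lemma smalloD V (A : set V) (x : V) (r s : V -> R) :
  smallo A x r -> smallo A x s -> smallo A x (fun z => r z + s z).
Proof.
move=> Hr Hs e e0; have e20 : 0 < e / 2 by rewrite divr_gt0.
apply: filterS2 (Hr _ e20) (Hs _ e20) => z Hz Hz'.
rewrite (le_trans (ler_normD _ _))// [e]splitr mulrDl.
exact: lerD.
Qed.

Lemma smalloM V (A : set V) (x : V) (c : R) (r : V -> R) :
  smallo A x r -> smallo A x (fun z => c * r z).
Proof.
move=> Hr e e0; have c0 : 0 < `|c| + 1 by rewrite ltr_pwDr.
have ec0 : 0 < e / (`|c| + 1) by rewrite divr_gt0.
apply: filterS (Hr _ ec0) => z Hz; rewrite normrM.
apply: (@le_trans _ _ ((`|c| + 1) * `|r z|)).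
  by rewrite ler_wpM2r// lerDl.
by rewrite mulrC -ler_pdivlMr// mulrAC.
Qed.

Lemma smallo0 V (A : set V) (x : V) : smallo A x (fun=> 0).
Proof.
by move=> e e0; apply: nearW => z; rewrite normr0 mulr_ge0// ltW.
Qed.

Lemma smallo_sum V (A : set V) (x : V) n (r : 'I_n -> V -> R) :
  (forall i, smallo A x (r i)) -> smallo A x (fun z => \sum_i r i z).
Proof.
elim: n r => [|n IHn] r Hr.
  have -> : (fun z => \sum_(i < 0) r i z) = fun=> 0.
    by apply: funext => z; rewrite big_ord0.
  exact: smallo0.
have -> : (fun z => \sum_i r i z) =
    fun z => r ord0 z + \sum_i r (lift ord0 i) z.
  by apply: funext => z; rewrite big_ord_recl.
by apply: smalloD => //; exact: IHn.
Qed.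

Lemma smallo_comp V W (A : set V) (B : set W) (h : V -> W) (x : V)
    (r : W -> R) :
  A x -> set_fun A B h -> [lipschitz h z | z in A] ->
  smallo B (h x) r -> smallo A x (fun z => r (h z)).
Proof.
move=> Ax AB /lipschitz_onP[M M0 HM] /smalloP Hr; apply/smalloP => e e0.
have N0 : 0 < M + 1 by rewrite ltr_pwDr.
have [dl dl0 Hdl] := Hr _ (divr_gt0 e0 N0).
exists (dl / (M + 1)) => [|z Az zx]; first by rewrite divr_gt0.
have hz : `|h z - h x| <= (M + 1) * `|z - x|.
  by rewrite (le_trans (HM _ _ Az Ax))// ler_wpM2r// lerDl.
apply: le_trans (Hdl _ (AB _ Az) _) _.
  by rewrite (le_lt_trans hz)// mulrC -ltr_pdivlMr.
by rewrite mulrAC ler_pdivrMr// -mulrA [_ * (M + 1)]mulrC ler_wpM2l// ltW.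
Qed.

Lemma gradP V dot (A : set V) (f : V -> R) (x : V) :
  (exists! g, is_grad dot A f x g) -> is_grad dot A f x (grad dot A f x).
Proof. by move=> [g [Hg _]]; rewrite /grad; apply: xgetPex; exists g. Qed.

Lemma is_gradS V dot (A B : set V) (f : V -> R) (x g : V) :
  A `<=` B -> is_grad dot B f x g -> is_grad dot A f x g.
Proof.
move=> AB /smalloP H; apply/smalloP => e /H[dl dl0 Hdl].
by exists dl => // z /AB; exact: Hdl.
Qed.

Lemma is_grad_comp V W dotV dotW (A : set V) (B : set W) (h : V -> W)
    (f : W -> R) (x g : V) (g' : W) :
  A x -> set_fun A B h -> [lipschitz h z | z in A] ->
  is_grad dotW B f (h x) g' ->
  smallo A x (fun z => dotW g' (h z - h x) - dotV g (z - x)) ->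
  is_grad dotV A (f \o h) x g.
Proof.
move=> Ax AB lh Hf Hh.
have := smalloD (smallo_comp Ax AB lh Hf) Hh.
rewrite /is_grad /smallo => H e e0; apply: filterS (H e e0) => z /=.
by rewrite subrKA.
Qed.

Lemma dotcDl n (u v w : 'cV[R]_n) : dotc (u + v) w = dotc u w + dotc v w.
Proof.
by rewrite /dotc -big_split; apply: eq_bigr => i _; rewrite mxE mulrDl.
Qed.

Lemma dotcZl n a (u w : 'cV[R]_n) : dotc (a *: u) w = a * dotc u w.
Proof.
by rewrite /dotc mulr_sumr; apply: eq_bigr => i _; rewrite mxE mulrA.
Qed.

(** Whether gradients are unique at a point depends only on the set: if one
    function has a unique gradient there, so has every differentiable one.
    Indeed the difference of two gradients of [f] may be added to a gradient
    of [f0]. *)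
Lemma is_grad_unique n (A : set 'cV[R]_n) (f0 f : 'cV[R]_n -> R)
    (x g : 'cV[R]_n) :
  (exists! g0, is_grad (@dotc R n) A f0 x g0) ->
  is_grad (@dotc R n) A f x g -> exists! g, is_grad (@dotc R n) A f x g.
Proof.
move=> [g0 [Hg0 Ug0]] Hg; exists g; split=> // g1 Hg1.
have /Ug0 : is_grad (@dotc R n) A f0 x (g0 + (g - g1)).
  have := smalloD Hg0 (smalloD Hg (smalloM (-1) Hg1)).
  rewrite /is_grad /smallo => H e e0; apply: filterS (H e e0) => z /=.
  rewrite -[- g1]scaleN1r !dotcDl dotcZl.
  by apply: le_trans; rewrite le_eqVlt; apply/orP; left; apply/eqP;
    congr `|_|; ring.
by move=> /eqP; rewrite addrC -subr_eq subrr eq_sym subr_eq0 => /eqP ->.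
Qed.

Lemma grad_eq V dot (A : set V) (f : V -> R) (x g : V) :
  (exists! g, is_grad dot A f x g) -> is_grad dot A f x g ->
  grad dot A f x = g.
Proof.
move=> [g0 [_ Ug0]] Hg; apply: xget_unique => // g1 Hg1.
by rewrite -(Ug0 _ Hg1) (Ug0 _ Hg).
Qed.

Lemma is_grad_chain n (B : set R) (A : set 'cV[R]_n) (f : R -> R)
    (h : 'cV[R]_n -> R) (x g : 'cV[R]_n) (g' : R) :
  A x -> set_fun A B h -> [lipschitz h z | z in A] ->
  is_grad (@dotr R) B f (h x) g' -> is_grad (@dotc R n) A h x g ->
  is_grad (@dotc R n) A (f \o h) x (g' *: g).
Proof.
move=> Ax AB lh Hf Hh; apply: is_grad_comp Ax AB lh Hf _.
have := smalloM g' Hh; congr smallo; apply: funext => z.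
by rewrite /dotr dotcZl mulrBr.
Qed.

End Gradients.

(** * Regularity of networks *)

Section Networks.
Variable R : realType.

(** A network is differentiable on the whole space, and its gradient is
    bounded and Lipschitz there: each layer multiplies the gradient of the
    next ones by bounded Lipschitz factors, the derivatives of the activation
    function.  (The network itself need not be bounded, its last layer being
    affine.) *)
Lemma network_regular (act : R -> R) n ws (theta : net_params R n ws) :
  W2inf (@dotr R) setT act ->
  exists D : 'cV[R]_n -> 'cV[R]_n,
  [/\ forall z, is_grad (@dotc R n) setT (network act theta) z (D z),
      [lipschitz network act theta z | z in setT]
    & forall j, W1inf setT (fun z => D z j 0)].
Proof.
move=> [act_grad [_ act_lip] Dact]; elim: ws n theta => [|m ws IHws] n /=.
  move=> [W b] /=; exists (fun=> W^T); split=> [z||j].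
  - rewrite /is_grad => e e0; apply: nearW => y.
    rewrite !mxE opprD addrACA subrr addr0 -sumrB /dotc -sumrB.
    rewrite big1 ?normr0 ?mulr_ge0 ?(ltW e0)//.
    by move=> i _; rewrite !mxE -mulrBr subrr.
  - exact: lipschitz_affine.
  - exact: W1inf_cst.
move=> [[W b] theta] /=.
have [D [D_grad N_lip D_W1]] := IHws m theta.
pose h z := map_mx act (W *m z + b).
pose u i (z : 'cV[R]_n) := (W *m z + b) i 0.
have u_lip i : [lipschitz u i z | z in setT] by exact: lipschitz_affine.
have h_lip : [lipschitz h z | z in setT].
  apply: lipschitz_col => i.
  have -> : (fun z => h z i 0) = act \o u i by apply: funext => z; rewrite mxE.
  exact: (lipschitz_comp (B := setT)).
pose act' := grad (@dotr R) setT act.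
pose D' z : 'cV[R]_n := \col_j \sum_i D (h z) i 0 * (act' (u i z) * W i j).
exists D'; split=> [z||j].
- apply: (is_grad_comp (B := setT) (h := h) _ _ h_lip (D_grad (h z))) => //.
  have : smallo setT z (fun y => \sum_i D (h z) i 0 *
      (act (u i y) - act (u i z) - act' (u i z) * (u i y - u i z))).
    apply: smallo_sum => i; apply: smalloM.
    apply: (smallo_comp (B := setT) (h := u i) _ _ (u_lip i)
      (r := fun t => act t - act (u i z) - act' (u i z) * (t - u i z))) => //.
    exact: (gradP (act_grad (u i z) _)).
  congr smallo; apply: funext => y; rewrite /dotc.
  under [X in _ = _ - X]eq_bigr => j _ do rewrite mxE mulr_suml.
  rewrite exchange_big /= -sumrB; apply: eq_bigr => i _.
  have -> : (h y - h z) i 0 = act (u i y) - act (u i z) by rewrite /u !mxE.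
  rewrite mulrBr; congr (_ - _).
  have -> : u i y - u i z = \sum_j W i j * (y - z) j 0.
    rewrite /u !mxE opprD addrACA subrr addr0 -sumrB.
    by apply: eq_bigr => j _; rewrite !mxE mulrBr.
  by rewrite !mulr_sumr; apply: eq_bigr => j _; rewrite !mulrA.
- exact: (lipschitz_comp (B := setT) (f := h)).
- have -> : (fun z => D' z j 0) =
      fun z => \sum_i D (h z) i 0 * (act' (u i z) * W i j).
    by apply: funext => z; rewrite mxE.
  apply: W1inf_sum => i; apply: W1infM.
    exact: (W1inf_comp (B := setT) (f := h) (g := fun y => D y i 0)).
  apply: W1infM; last exact: W1inf_cst.
  exact: (W1inf_comp (B := setT) (f := u i)).
Qed.

(** Any function [f0] with unique gradients relative to [A] serves to ensure
    that the gradient of the network relative to [A] is unique. *)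
Lemma network_W2inf (act : R -> R) n ws (theta : net_params R n ws)
    (A : set 'cV[R]_n) (f0 : 'cV[R]_n -> R) :
  W2inf (@dotr R) setT act -> [bounded x | x in A] ->
  (forall x, A x -> exists! g, is_grad (@dotc R n) A f0 x g) ->
  W2inf (@dotc R n) A (network act theta).
Proof.
move=> act_W2 A_bnd A_unique.
have [D [D_grad N_lip D_W1]] := network_regular theta act_W2.
have N_grad x : A x -> is_grad (@dotc R n) A (network act theta) x (D x).
  by move=> Ax; exact: is_gradS (D_grad x).
have N_unique x : A x ->
    exists! g, is_grad (@dotc R n) A (network act theta) x g.
  by move=> Ax; exact: is_grad_unique (A_unique x Ax) (N_grad x Ax).
split=> //; apply: lipschitz_bounded => //; first exact: lipschitz_onS N_lip.
have /lipschitz_onP[M M0 HM] : [lipschitz D x | x in setT].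
  by apply: lipschitz_col => l; case: (D_W1 l).
apply/lipschitz_onP; exists M => // x y Ax Ay.
rewrite (grad_eq (N_unique x Ax) (N_grad x Ax)).
by rewrite (grad_eq (N_unique y Ay) (N_grad y Ay)); exact: HM.
Qed.

End Networks.

(** * Surrogate costs *)

Section Surrogate.
Variable R : realType.

(** The hypothesis [W2inf] makes the supremum and the infima in the norm of [f]
    genuine bounds. *)
Lemma W2inf_norm_bounds (V : normedModType R) dot (A : set V) (f : V -> R) c :
  W2inf dot A f -> W2inf_norm dot A f <= c ->
  [/\ forall x y, A x -> A y -> `|f x - f y| <= c * `|x - y|,
      forall x, A x -> `|grad dot A f x| <= c
    & forall x y, A x -> A y ->
        `|grad dot A f x - grad dot A f y| <= c * `|x - y|].
Proof.
move=> [_ [_ f_lip] [Df_bnd Df_lip]].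
rewrite /W2inf_norm /W1inf_norm !ge_max => /and3P[/andP[_ c1] c2 c3].
split=> [x y Ax Ay|x Ax|x y Ax Ay].
- by rewrite (le_trans (lip_constP f_lip Ax Ay))// ler_wpM2r.
- exact: le_trans (sup_normP Df_bnd Ax) c2.
- by rewrite (le_trans (lip_constP Df_lip Ax Ay))// ler_wpM2r.
Qed.

Variables (n : nat) (A : set 'cV[R]_n) (Z : set R).
Variables (L : 'cV[R]_n -> R) (G : R -> R) (cL cG : R).
Hypotheses (L_AZ : set_fun A Z L).
Hypotheses (L_W2 : W2inf (@dotc R n) A L) (G_W2 : W2inf (@dotr R) Z G).
Hypotheses (L_norm : W2inf_norm (@dotc R n) A L <= cL).
Hypotheses (G_norm : W2inf_norm (@dotr R) Z G <= cG).

Local Notation D := (grad (@dotc R n) A).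

Lemma grad_surrogate (f : 'cV[R]_n -> R) (x : 'cV[R]_n) :
  set_fun A Z f -> W2inf (@dotc R n) A f -> A x ->
  D (G \o f) x = grad (@dotr R) Z G (f x) *: D f x.
Proof.
move=> f_AZ [f_grad [_ f_lip] _] Ax; case: G_W2 => G_grad _ _.
have fx_grad : is_grad (@dotc R n) A (G \o f) x
    (grad (@dotr R) Z G (f x) *: D f x).
  apply: (is_grad_chain (B := Z)) (gradP (f_grad x Ax)) => //.
  exact: gradP (G_grad _ (f_AZ _ Ax)).
exact: grad_eq (is_grad_unique (f_grad x Ax) fx_grad) fx_grad.
Qed.

(** Of the two factors of a product gradient, it is the gradient of [L] that
    is split off with the variation of [G'], so that no bound on the gradient
    of the surrogate [f] is needed. *)
Lemma grad_surrogate_dist (f : 'cV[R]_n -> R) (x y : 'cV[R]_n) :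
  set_fun A Z f -> W2inf (@dotc R n) A f -> A x -> A y ->
  `|D (G \o L) x - D (G \o f) y| <=
    cG * cL * `|L x - f y| + cG * `|D L x - D f y|.
Proof.
move=> f_AZ f_W2 Ax Ay.
have [_ DL_le _] := W2inf_norm_bounds L_W2 L_norm.
have [_ DG_le DG_lip] := W2inf_norm_bounds G_W2 G_norm.
rewrite (grad_surrogate f_AZ)// (grad_surrogate L_AZ)//.
set a := grad _ Z G (L x); set b := grad _ Z G (f y).
have -> : a *: D L x - b *: D f y = (a - b) *: D L x + b *: (D L x - D f y).
  by rewrite scalerBl scalerBr addrA subrK.
rewrite (le_trans (ler_normD _ _))// !normrZ lerD//.
- rewrite mulrAC ler_pM ?DL_le//.
  exact: DG_lip (L_AZ Ax) (f_AZ _ Ay).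
- by rewrite ler_wpM2r// DG_le//; exact: f_AZ.
Qed.

End Surrogate.

Lemma norm_sub_transport (R : realType) (V : normedModType R)
    (a b a' b' : V) :
  `|a - b| <= `|a' - b'| + (`|a - a'| + `|b - b'|).
Proof.
have -> : a - b = (a' - b') + ((a - a') - (b - b')).
  have -> : (a - a') - (b - b') = (a - b) - (a' - b').
    by rewrite opprD addrACA -opprD.
  by rewrite addrCA subrr addr0.
by rewrite (le_trans (ler_normD _ _))// lerD2l ler_normB.
Qed.

Section Loss.
Variables (R : realType) (d : nat) (Y : set 'cV[R]_d) (L : 'cV[R]_d -> R).
Variables (S : {fset 'cV[R]_d}) (f : 'cV[R]_d -> R).

Lemma lip_loss_ge0 : 0 <= lip_loss Y L S f.
Proof. exact: bigmax_ge_id. Qed.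

Lemma le_lip_loss y : y \in S ->
  `|L y - f y| + `|grad (@dotc R d) Y L y - grad (@dotc R d) Y f y| <=
  lip_loss Y L S f.
Proof.
move=> yS; pose F z :=
  `|L z - f z| + `|grad (@dotc R d) Y L z - grad (@dotc R d) Y f z|.
exact: (Order.TotalTheory.le_bigmax_seq 0 y xpredT F yS isT).
Qed.

(** A training point [y] controls the error at [z]: the errors of [f] and of
    its gradient each grow by at most [(cL + cf) |z - y|] between them. *)
Lemma lip_loss_transport (cL cf r : R) (y z : 'cV[R]_d) :
  W2inf (@dotc R d) Y L -> W2inf_norm (@dotc R d) Y L <= cL ->
  W2inf (@dotc R d) Y f -> W2inf_norm (@dotc R d) Y f <= cf ->
  Y y -> Y z -> y \in S -> `|z - y| <= r / 2 -> 0 <= cL + cf ->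
  `|L z - f z| + `|grad (@dotc R d) Y L z - grad (@dotc R d) Y f z| <=
  lip_loss Y L S f + (cL + cf) * r.
Proof.
move=> L_W2 L_norm f_W2 f_norm Yy Yz yS zy c0.
have [/(_ z y Yz Yy) L_zy _ /(_ z y Yz Yy) DL_zy] :=
  W2inf_norm_bounds L_W2 L_norm.
have [/(_ z y Yz Yy) f_zy _ /(_ z y Yz Yy) Df_zy] :=
  W2inf_norm_bounds f_W2 f_norm.
apply: le_trans (lerD (norm_sub_transport _ _ (L y) (f y))
  (norm_sub_transport _ _ (grad (@dotc R d) Y L y) (grad (@dotc R d) Y f y))) _.
rewrite addrACA lerD ?le_lip_loss// [r]splitr mulrDr lerD//.
  rewrite (le_trans (lerD L_zy f_zy))// -mulrDl.
  exact: ler_wpM2l.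
rewrite (le_trans (lerD DL_zy Df_zy))// -mulrDl.
exact: ler_wpM2l.
Qed.

End Loss.

(** * The ISMO iteration *)

Lemma executed_leq (R : realType) (d dN : nat) (cost : 'cV[R]_d -> R) eps
    (ybar : nat -> 'I_dN -> 'cV[R]_d) k l :
  (k <= l)%N -> executed cost eps ybar l -> executed cost eps ybar k.
Proof.
by move=> kl Hl avg i /andP[i0 ik]; apply: Hl; rewrite i0 (leq_trans ik).
Qed.

(** A Lipschitz map on the cube and a Lipschitz left inverse have constants of
    product at least [1]: compare them at the corners [0] and [(1, ..., 1)]. *)
Lemma lipschitz_inverse_ge1 (R : realType) (d : nat) (W : normedModType R)
    (B : set W) (f : 'cV[R]_d -> W) (g : W -> 'cV[R]_d) (c K : R) :
  (0 < d)%N -> 0 <= K -> set_fun (unit_cube R d) B f ->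
  (forall y, unit_cube R d y -> g (f y) = y) ->
  (forall x y, unit_cube R d x -> unit_cube R d y ->
     `|f x - f y| <= c * `|x - y|) ->
  (forall p q, B p -> B q -> `|g p - g q| <= K * `|p - q|) ->
  1 <= K * c.
Proof.
move=> d0 K0 fB gK f_lip g_lip.
pose u : 'cV[R]_d := const_mx 1.
have Y0 : unit_cube R d 0 by move=> i; rewrite mxE lexx ler01.
have Y1 : unit_cube R d u by move=> i; rewrite mxE lexx ler01.
have u_gt0 : 0 < `|u|.
  apply: lt_le_trans (ler_norm_coord u (Ordinal d0)).
  by rewrite mxE normr1.
rewrite -(ler_pM2r u_gt0) mul1r -mulrA.
have := g_lip _ _ (fB _ Y1) (fB _ Y0); rewrite !gK// subr0 => /le_trans; apply.
by rewrite ler_wpM2l//; have := f_lip _ _ Y1 Y0; rewrite subr0.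
Qed.

Section Sigma.
Variables (R : realType) (d dN : nat) (E CL : nat -> R) (sigma0 : R).
Local Notation sigma := (ismo_sigma d dN E CL sigma0).

Lemma ismo_sigma_ge0 k :
  0 <= sigma0 -> (forall i, 0 <= E i) -> (forall i, 0 <= CL i) -> 0 <= sigma k.
Proof.
move=> s0 E0 CL0; elim: k => //= k IHk.
by rewrite addr_ge0// mulr_ge0 ?divr_ge0 ?powR_ge0// addr_ge0 ?invr_ge0.
Qed.

(** For well-trained networks, [sigma] is dominated by a geometric sequence of
    ratio [dN ^ (- 1 / d)]. *)
Lemma ismo_sigma_le k :
  0 <= sigma0 -> (forall i, 0 <= E i) -> (forall i, 0 <= CL i) ->
  (forall i, (i < k)%N -> CL i.+1 <= 3^-1 /\
     E i.+1 <= 3^-1 * (sigma i / dN%:R `^ d%:R^-1)) ->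
  sigma k <= sigma0 / dN%:R `^ (k%:R / d%:R).
Proof.
move=> s0 E0 CL0; elim: k => [|k IHk] Hk.
  by rewrite mul0r powRr0 divr1.
have -> : dN%:R `^ (k.+1%:R / d%:R) =
    dN%:R `^ (k%:R / d%:R) * dN%:R `^ d%:R^-1 :> R.
  by rewrite ![_%:R / _]mulrC !powRrM !powR_mulrn ?powR_ge0// exprSr.
rewrite invfM mulrA.
have {}IHk := IHk (fun i ik => Hk i (ltnW ik)).
have [CLk Ek] := Hk k (ltnSn k).
set t := (_ `^ d%:R^-1)^-1 in Ek *.
have t0 : 0 <= t by rewrite invr_ge0 powR_ge0.
apply: le_trans (_ : sigma k * t <= _); last by rewrite ler_wpM2r.
have st0 : 0 <= sigma k * t by rewrite mulr_ge0// ismo_sigma_ge0.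
rewrite /= -/t; nra.
Qed.

End Sigma.

Theorem lemma4p3 (R : realType) (d : nat) (hd : (0 < d)%N)
    (Z X : set R) (L : 'cV[R]_d -> R) (G : R -> R)
    (* H1-H4 *)
    (Y := unit_cube R d)
    (W2Y := W2inf_norm (@dotc R d) Y)
    (gradY := grad (@dotc R d) Y)
    (cost := G \o L)
    (L_YZ : set_fun Y Z L) (G_ZX : set_fun Z X G)
    (H1 : W2inf (@dotc R d) Y L) (H1_norm : W2Y L <= 3^-1)
    (H2 : W2inf (@dotr R) Z G) (H2_norm : W2inf_norm (@dotr R) Z G <= 3^-1)
    (ymin : 'cV[R]_d)
    (H3_global : is_argmin Y cost ymin)
    (H3_unique : forall y, is_argmin Y cost y -> y = ymin)
    (H3_local : forall y, local_min Y cost y -> y = ymin)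
    (H3_grad : gradY cost ymin = 0)
    (Yc : set 'cV[R]_d) (gradinv : 'cV[R]_d -> 'cV[R]_d)
    (H4_fun : set_fun Y Yc (gradY cost)) (H4_inv_fun : set_fun Yc Y gradinv)
    (H4_left : forall y, Y y -> gradinv (gradY cost y) = y)
    (H4_right : forall p, Yc p -> gradY cost (gradinv p) = p)
    (H4 : W1inf Yc gradinv)
    (Cinv := W1inf_norm Yc gradinv)
    (* network class *)
    (act : R -> R) (act_W2 : W2inf (@dotr R) setT act)
    (ws : seq nat) (ws_nonempty : (0 < size ws)%N)
    (ws_pos : all (fun m => (0 < m)%N) ws)
    (Theta : set (net_params R d ws))
    (* inputs of the optimization algorithm and of ISMO *)
    (update : 'M[R]_d -> 'cV[R]_d -> 'cV[R]_d -> 'cV[R]_d -> 'cV[R]_d ->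
              'M[R]_d)
    (tol eps : R)
    (N0 dN : nat) (hdN : (0 < dN <= N0)%N)
    (y0 : 'I_N0 -> 'cV[R]_d) (y0_inj : injective y0) (y0_Y : forall i, Y (y0 i))
    (* the ISMO run *)
    (theta : nat -> net_params R d ws)
    (ystart ybar : nat -> 'I_dN -> 'cV[R]_d) (B0 : nat -> 'I_dN -> 'M[R]_d)
    (Lnet := fun k => network act (theta k))
    (Gnet := fun k => G \o Lnet k)
    (S := train_set y0 ybar)
    (run := executed cost eps ybar)
    (E := fun k => lip_loss Y L (S k) (Lnet k))
    (training : forall k, run k ->
       is_argmin Theta (fun t => lip_loss Y L (S k) (network act t)) (theta k))
    (Lnet_YZ : forall k, run k -> set_fun Y Z (Lnet k))
    (ystart_Y : forall k j, run k -> Y (ystart k j))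
    (H5 : Y `<=` \bigcup_(i in [set: 'I_N0])
                   ball_diam (y0 i) (N0%:R `^ (- d%:R^-1)))
    (H6_converges : forall k j, run k ->
       quasi_newton update tol Y (Gnet k) (B0 k j) (ystart k j) (ybar k j))
    (H6_local_min : forall k j, run k ->
       local_min Y (Gnet k) (ybar k j) /\ gradY (Gnet k) (ybar k j) = 0)
    (net0_norm : W2Y (Lnet 0%N) <= 3^-1)
    (net0_error : E 0%N <= 3^-1 * N0%:R `^ (- d%:R^-1))
    (C := 4 * Cinv / 9)
    (sigma0 : R) (hsigma0 : 0 < sigma0 < 1)
    (hN0 : (C / sigma0) ^+ d <= N0%:R)
    (sigma := ismo_sigma d dN E (fun k => W2Y (Lnet k)) sigma0)
    (H7 : forall k j, (1 <= k)%N -> run k ->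
       (\bigcup_(i in [set: 'I_dN])
          ball_diam (ybar k.-1 i) (sigma k.-1 / dN%:R `^ d%:R^-1)) (ybar k j)) :
  (forall k j, (1 <= k)%N -> run k -> `|ymin - ybar k j| <= C * sigma k)
  /\
  ((forall k, (1 <= k)%N -> run k ->
      W2Y (Lnet k) <= 3^-1 /\
      E k <= 3^-1 * (sigma k.-1 / dN%:R `^ d%:R^-1)) ->
   forall k j, (1 <= k)%N -> run k ->
     `|ymin - ybar k j| <= C ^+ k * sigma0 / dN%:R `^ (k%:R / d%:R)).
Proof.
have /andP[s0 _] := hsigma0.
have [L_grad _ _] := H1.
have [L_lip3 _ DL_lip3] := W2inf_norm_bounds H1 H1_norm.
have Y_bnd : [bounded x | x in Y].
  apply/bounded_onP; exists 1 => // x Yx; apply: norm_col_le => // i.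
  by have /andP[x0 x1] := Yx i; rewrite ger0_norm.
have Cinv0 : 0 <= Cinv by rewrite le_max lip_const_ge0 orbT.
have gradinv_lip p q : Yc p -> Yc q ->
    `|gradinv p - gradinv q| <= Cinv * `|p - q|.
  move=> Yp Yq; case: H4 => _ /lip_constP/(_ _ _ Yp Yq)/le_trans; apply.
  by rewrite ler_wpM2r// le_max lexx orbT.
have C1 : 1 <= C.
  (* [4 / 27 = 3^-1 * 3^-1 * 3^-1 + 3^-1 * 3^-1]. *)
  have cost_lip x y : Y x -> Y y ->
      `|gradY cost x - gradY cost y| <= 4 / 27 * `|x - y|.
    move=> Yx Yy.
    have := grad_surrogate_dist L_YZ H1 H2 H1_norm H2_norm L_YZ H1 Yx Yy.
    move=> /le_trans; apply.
    have := L_lip3 x y Yx Yy; have := DL_lip3 x y Yx Yy.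
    rewrite -/gradY; move: `|_ - _| `|L x - _| `|x - y| => a b t; clear; lra.
  have := lipschitz_inverse_ge1 hd Cinv0 H4_fun H4_left cost_lip gradinv_lip.
  by rewrite /C; move: (Cinv) => K; clear; lra.
have CL0 k : 0 <= W2Y (Lnet k).
  by rewrite le_max le_max lip_const_ge0 orbT.
have E0 k : 0 <= E k by exact: lip_loss_ge0.
have sigma_ge0 k : 0 <= sigma k by apply: ismo_sigma_ge0 => //; exact: ltW.
have main k j : (1 <= k)%N -> run k -> `|ymin - ybar k j| <= C * sigma k.
  case: k j => // k j _ rk1; have rk : run k by exact: executed_leq rk1.
  have [[Yz _] z_crit] := H6_local_min _ j rk1.
  have [i _ zi] := H7 k.+1 j isT rk1; have [[Yi _] _] := H6_local_min _ i rk.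
  rewrite /ball_diam /= in zi.
  set f := Lnet k.+1; set z := ybar k.+1 j in Yz zi *.
  set y := ybar k i in Yi zi.
  have f_W2 : W2inf (@dotc R d) Y f by exact: network_W2inf L_grad.
  have yS : y \in S k.+1.
    by rewrite /S /= in_fsetU; apply/orP; right; exact: in_imfset.
  have loss_z : `|L z - f z| + `|gradY L z - gradY f z| <= sigma k.+1.
    apply: (lip_loss_transport H1 H1_norm f_W2 (lexx _) Yi Yz yS zi).
    by rewrite addr_ge0 ?invr_ge0 ?CL0.
  have cost_z : `|gradY cost z| <= 3^-1 * sigma k.+1.
    have := grad_surrogate_dist L_YZ H1 H2 H1_norm H2_norm (Lnet_YZ _ rk1) f_W2
      Yz Yz.
    rewrite -/gradY -/cost z_crit subr0 => /le_trans; apply.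
    (* The factor [3^-1 * 3^-1] of the first error is weakened to [3^-1]. *)
    apply: le_trans (_ : 3^-1 * (`|L z - f z| + `|gradY L z - gradY f z|) <= _).
      by rewrite mulrDr lerD2r ler_wpM2r// ler_piMr ?invf_le1 ?ler1n ?invr_ge0.
    by rewrite ler_wpM2l ?invr_ge0.
  have [Ymin _] := H3_global.
  rewrite -[ymin]H4_left// -[z]H4_left// H3_grad.
  have := gradinv_lip _ _ (H4_fun _ Ymin) (H4_fun _ Yz).
  rewrite H3_grad sub0r normrN => /le_trans; apply.
  rewrite (le_trans (ler_wpM2l Cinv0 cost_z))// mulrA ler_wpM2r//.
  by rewrite /C; move: (Cinv) Cinv0 => K; clear; lra.
split=> // trained k j k1 rk; apply: le_trans (main k j k1 rk) _.
have sigma_k : sigma k <= sigma0 / dN%:R `^ (k%:R / d%:R).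
  apply: ismo_sigma_le => //; first exact: ltW.
  by move=> i ik; apply: (trained i.+1 isT); exact: executed_leq rk.
rewrite -mulrA; apply: ler_pM => //; first exact: le_trans C1.
by rewrite -(prednK k1) exprS ler_peMr ?exprn_ege1//; exact: le_trans C1.
Qed.
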